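(* Consider the Lamé differential equation $$(4z^3-1)\frac{d^2y}{dz^2}+6z^2\frac{dy}{dz}-\frac{7}{36}zy=0,$$ written as the system $Y'=\mathsf A Y$ for $Y=[y,\frac{dy}{dz}]^{t}$, and let $\mathsf A_1=\mathsf A$, $\mathsf A_{m+1}=\frac{\partial\mathsf A_m}{\partial z}+\mathsf A_m\mathsf A$. Then $\mathsf A_5\equiv 0$ modulo $5$, but $\mathsf A_{25}\not\equiv 0$ modulo $5^6$.
   Context: Explicitly, with $P(z)=4z^3-1$, $$\mathsf A=\begin{bmatrix}0&1\\ \frac{7z}{36P(z)}&-\frac{P'(z)}{2P(z)}\end{bmatrix}.$$ All $\mathsf A_m$ have entries in the ring $S=\mathbb Z[z,\frac{1}{36P(z)}]$; congruence modulo $5^k$ means equality in $S/5^kS$. (Note $\mathrm{ord}_5(25!)=6$.) *)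

(* Defs.v *)
From HB Require Import structures.
From mathcomp Require Import all_boot all_order all_algebra.
From mathcomp Require Import ring.

Set Implicit Arguments.
Unset Strict Implicit.
Unset Printing Implicit Defensive.

Import GRing.Theory Num.Theory.
Local Open Scope ring_scope.

Notation "x %:F" := (@FracField.tofrac _ x) : ring_scope.

(* The quotient rule, applied to the representative chosen by [repr];
   [dfrac_div] below shows that the choice of representative is immaterial. *)
Definition dfrac (K : idomainType) (f : {fraction {poly K}}) :
    {fraction {poly K}} :=
  let n := (repr f).1 in let d := (repr f).2 in
  (n^`() * d - n * d^`())%:F / (d ^+ 2)%:F.

Lemma frac_repr (R : idomainType) (f : {fraction R}) :
  f = (repr f).1%:F / (repr f).2%:F.
Proof.
rewrite -[LHS]reprK; move: (repr f) => r.
have nz : r.2%:F != 0 :> {fraction R} by rewrite tofrac_eq0 denom_ratioP.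
apply: (canRL (mulfK nz)); unlock FracField.tofrac.
rewrite -[LHS]FracField.pi_mul; apply/eqmodP => /=.
rewrite FracField.equivfE /FracField.mulf.
rewrite !numden_Ratio ?mulr1 ?oner_eq0 ?denom_ratioP //.
by rewrite mulrC.
Qed.

Lemma dfrac_div (K : idomainType) (n d : {poly K}) : d != 0 ->
  dfrac (n%:F / d%:F) = (n^`() * d - n * d^`())%:F / (d ^+ 2)%:F.
Proof.
move=> d0; rewrite /dfrac; set f := n%:F / d%:F.
have := frac_repr f; have := denom_ratioP (repr f).
move: (repr f).1 (repr f).2 => a b b0 /eqP.
rewrite /f eqr_div ?tofrac_eq0 // -!tofracM tofrac_eq => /eqP eq_nb.
apply/eqP; rewrite eqr_div ?tofrac_eq0 ?expf_neq0 // -!tofracM tofrac_eq.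
have /(congr1 (@deriv _)) := eq_nb; rewrite !derivM => eq_d.
apply/eqP; apply: (mulfI b0); apply: (mulfI d0).
apply/eqP; rewrite -subr_eq0; apply/eqP.
transitivity (b ^+ 2 * d ^+ 2 *
  ((a^`() * d + a * d^`()) - (n^`() * b + n * b^`()))
  + (b ^+ 2 * d * d^`() + b * d ^+ 2 * b^`()) * (n * b - a * d)); first by ring.
by rewrite eq_d eq_nb !subrr !mulr0 addr0.
Qed.

Lemma dfrac_tofrac (K : idomainType) (p : {poly K}) : dfrac p%:F = (p^`())%:F.
Proof.
rewrite -[p%:F]divr1 -tofrac1 dfrac_div ?oner_neq0 //.
by rewrite expr1n tofrac1 divr1 derivC mulr0 subr0 mulr1.
Qed.

(* The rational functions Q(z), as the fraction field of Z[z]. *)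
Notation ratfun := {fraction {poly int}}.

Definition zvar : ratfun := 'X%:F.

Definition lameP : {poly int} := 4 *: 'X^3 - 1.

Definition lameA : 'M[ratfun]_2 := \matrix_(i, j)
  if i == 0 then (if j == 0 then 0 else 1)
  else if j == 0 then 7 * zvar / (36 * lameP%:F)
       else - (lameP^`())%:F / (2 * lameP%:F).

(* The intended range is m >= 1; lameA_ 0 = lameA is a dummy value. *)
Definition lameA_ (m : nat) : 'M[ratfun]_2 :=
  iter m.-1 (fun B => map_mx (@dfrac _) B + B *m lameA) lameA.

(* The subring S = Z[z, 1 / (36 P(z))] of Q(z). *)
Definition in_S (f : ratfun) : Prop :=
  exists (p : {poly int}) (n : nat), f = p%:F / (36 * lameP%:F) ^+ n.

(* Equality in S / q^k S of matrices with entries in S. *)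
Definition congrS (q k : nat) (B C : 'M[ratfun]_2) : Prop :=
  exists D : 'M[ratfun]_2,
    (forall i j, in_S (D i j)) /\ B - C = (q%:R ^+ k) *: D.

Lemma P_neq0 : lameP != 0.
Proof.
by apply/eqP => /(congr1 (fun p : {poly int} => p`_0)); rewrite /lameP !coefE.
Qed.

Lemma den_poly : 36 * lameP%:F = (36 * lameP)%:F :> ratfun.
Proof. by rewrite tofracM rmorph_nat. Qed.

Lemma den_poly_neq0 : 36 * lameP != 0.
Proof. by rewrite mulf_neq0 ?P_neq0 // -polyC_natr polyC_eq0. Qed.

Lemma P_frac_neq0 : lameP%:F != 0 :> ratfun.
Proof. by rewrite tofrac_eq0 P_neq0. Qed.

Lemma nat_frac_neq0 (n : nat) : (n != 0)%N -> n%:R != 0 :> ratfun.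
Proof.
by rewrite -tofrac1 -tofracMn tofrac_eq0 -polyC_natr polyC_eq0 pnatr_eq0.
Qed.

Lemma den_neq0 : 36 * lameP%:F != 0 :> ratfun.
Proof. by apply: mulf_neq0; [apply: nat_frac_neq0 | apply: P_frac_neq0]. Qed.

Lemma in_S_add f g : in_S f -> in_S g -> in_S (f + g).
Proof.
move=> [p [n ->]] [q [m ->]].
exists (p * (36 * lameP) ^+ m + q * (36 * lameP) ^+ n), (n + m)%N.
rewrite addf_div ?expf_neq0 ?den_neq0 // den_poly exprD.
by rewrite -!tofracXn -!tofracM -tofracD.
Qed.

Lemma in_S_mul f g : in_S f -> in_S g -> in_S (f * g).
Proof.
move=> [p [n ->]] [q [m ->]]; exists (p * q), (n + m)%N.
by rewrite mulf_div exprD tofracM.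
Qed.

Lemma in_S_poly p : in_S p%:F.
Proof. by exists p, 0%N; rewrite expr0 divr1. Qed.

Lemma in_S_dfrac f : in_S f -> in_S (dfrac f).
Proof.
move=> [p [n ->]]; rewrite den_poly -tofracXn.
rewrite dfrac_div ?expf_neq0 ?den_poly_neq0 // -exprM tofracXn -den_poly.
by eexists; exists (n * 2)%N.
Qed.

Lemma den_aux (F : fieldType) (a b : F) :
  a != 0 -> 2 != 0 :> F -> 36 != 0 :> F -> - b / (2 * a) = - (18 * b) / (36 * a).
Proof. by move=> a0 n2 n36; field; rewrite a0 n2 n36. Qed.

Lemma in_S_lameA i j : in_S (lameA i j).
Proof.
rewrite mxE; case: ifP => _; case: ifP => _.
- by rewrite -tofrac0; apply: in_S_poly.
- by rewrite -tofrac1; apply: in_S_poly.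
- by exists (7 * 'X), 1%N; rewrite expr1 tofracM rmorph_nat.
- exists (- (18 * lameP^`())), 1%N; rewrite expr1 tofracN tofracM rmorph_nat.
  exact: den_aux P_frac_neq0 (@nat_frac_neq0 2 _) (@nat_frac_neq0 36 _).
Qed.

Lemma in_S_lameA_ m i j : in_S (lameA_ m i j).
Proof.
rewrite /lameA_; elim: m.-1 i j => [|n IHn] i j /=; first exact: in_S_lameA.
rewrite mxE; apply: in_S_add; first by rewrite mxE; apply/in_S_dfrac/IHn.
rewrite mxE; apply: (big_ind in_S) => [||k _].
- by rewrite -tofrac0; apply: in_S_poly.
- exact: in_S_add.
- exact: in_S_mul (IHn _ _) (in_S_lameA _ _).
Qed.

(* The Lame equation is the system Y' = lameA Y for Y = [y, y']^t; here y
   lives in an arbitrary extension K of Q(z) and D stands for d/dz on K. *)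
Lemma lame_system (K : fieldType) (io : {rmorphism ratfun -> K}) (D : K -> K)
    (y : K) (Y := \col_(i < 2) (if i == 0 then y else D y)) :
  (4 * io zvar ^+ 3 - 1) * D (D y) + 6 * io zvar ^+ 2 * D y
    - 7 / 36 * io zvar * y = 0
  <-> map_mx D Y = map_mx io lameA *m Y.
Proof.
have ioN n : n != 0%N -> n%:R != 0 :> K.
  by move=> n0; rewrite -(rmorph_nat io) fmorph_eq0 nat_frac_neq0.
have PE : io lameP%:F = 4 * io zvar ^+ 3 - 1.
  rewrite /lameP tofracB tofrac1 rmorphB rmorph1 -mul_polyC polyC_natr.
  by rewrite tofracM tofracXn -/zvar rmorphM rmorphXn !rmorph_nat.
have dPE : io (lameP^`())%:F = 12 * io zvar ^+ 2.
  rewrite /lameP derivB derivZ derivXn derivC subr0 -mul_polyC polyC_natr.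
  rewrite mulrnAr -mulrnAl -mulrnA.
  by rewrite tofracM tofracXn -/zvar rmorphM rmorphXn !rmorph_nat.
have P0 : 4 * io zvar ^+ 3 - 1 != 0 by rewrite -PE fmorph_eq0 P_frac_neq0.
have E : (map_mx io lameA *m Y) 1 0 =
    7 * io zvar / (36 * (4 * io zvar ^+ 3 - 1)) * y
    - 12 * io zvar ^+ 2 / (2 * (4 * io zvar ^+ 3 - 1)) * D y.
  rewrite !mxE !big_ord_recl big_ord0 addr0 !mxE /= !rmorphM !fmorphV !rmorphM.
  by rewrite rmorphN !rmorph_nat PE dPE !mulNr.
split=> [lame | sys].
  apply/matrixP => i j; rewrite ord1; case: (unliftP 0 i) => [k ->|->].
    rewrite ord1 (_ : lift 0 0 = 1); last exact: val_inj.
    rewrite E !mxE /=; apply: (mulfI P0); apply/eqP; rewrite -subr_eq0 -lame.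
    by apply/eqP; field; rewrite P0 !ioN.
  rewrite !mxE !big_ord_recl big_ord0 !mxE /=.
  by rewrite rmorph0 rmorph1 mul0r mul1r add0r addr0.
have := congr1 (fun M : 'cV_2 => M 1 0) sys; rewrite E !mxE /= => ->.
by field; rewrite P0 !ioN.
Qed.

(* Main.v *)
Require Import Defs.
From mathcomp Require Import all_boot all_order all_algebra.
From mathcomp Require Import ring ssrAC.

Set Implicit Arguments.
Unset Strict Implicit.
Unset Printing Implicit Defensive.

Import GRing.Theory.
Local Open Scope ring_scope.

(** If [Y' = A Y] then [A_m] expresses the [m]-th derivative of [Y] in terms of
    [Y].  Its two rows are therefore consecutive terms of one sequence of row
    vectors: [r_0 = (1, 0)] stands for [y], [r_1 = (0, 1)] for [y'], and
    [r_m], which stands for the [m]-th derivative of [y], is obtained by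
    iterating the operator [along v = v' + v A].  Row [i] of [A_m] is
    [r_(m+i)] ([row_lameA_]).

    Multiplied by 36, the equation is a relation between [r_2], [r_1], [r_0]
    with coefficients in [Z[z]] of degrees 3, 2 and 1.  Each drop of the order
    of derivation goes with a drop of the degree, so that Leibniz' rule turns
    the successive derivatives of the relation into the four-term recurrence
    [differentiated_ode]

      36 P r_(n+3) + 216 (2n+3) z^2 r_(n+2) + (432 (n+1)^2 - 7) z r_(n+1)
        + (n+1) (12n-1) (12n+7) r_n = 0,

    and both claims are read off from it.

    Modulo 5, three instances of the recurrence and the equation itself
    combine to [r_5 = 0] ([lame_row5_mod5]).  For [n = 3] the coefficients of
    [r_4] and [r_3] are divisible by 5, so that [r_6 = 0] as well
    ([lame_row6_mod5]); these are the rows of [A_5].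

    Modulo [z] the recurrence only has two terms, because [P = -1] there:
    [36 r_(n+3) = (n+1) (12n-1) (12n+7) r_n].  Starting from the second entry
    1 of [r_1] one reaches that of [r_25] in eight steps, and the product of
    the eight factors has 5-adic valuation 5 ([logn5_taylor_num]).  The
    value of that entry at 0 is the 25th derivative at 0 of the solution with
    [y(0) = 0] and [y'(0) = 1].  Were the entry in [5^6 S], setting [z = 0], where the denominators
    [36 P] take the value -36, prime to 5, would make [5^6] divide the product
    ([S_dvd_const]). *)

(** * Derivation of fractions *)

(** Leibniz' rule and additivity for quotients, the primed variables standing
    for the derivatives. *)
Lemma quotient_ruleM (F : fieldType) (a b c d a' b' c' d' : F) :
    b != 0 -> d != 0 ->
  ((a' * c + a * c') * (b * d) - a * c * (b' * d + b * d')) / (b * d) ^+ 2 =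
  (a' * b - a * b') / b ^+ 2 * (c / d) + a / b * ((c' * d - c * d') / d ^+ 2).
Proof. by move=> b0 d0; field; rewrite b0 d0. Qed.

Lemma quotient_ruleD (F : fieldType) (a b c d a' b' c' d' : F) :
    b != 0 -> d != 0 ->
  ((a' * d + a * d' + (c' * b + c * b')) * (b * d)
     - (a * d + c * b) * (b' * d + b * d')) / (b * d) ^+ 2 =
  (a' * b - a * b') / b ^+ 2 + (c' * d - c * d') / d ^+ 2.
Proof. by move=> b0 d0; field; rewrite b0 d0. Qed.

Section FractionDerivation.
Variable K : idomainType.
Implicit Types f g : {fraction {poly K}}.

Lemma dfracM f g : dfrac (f * g) = dfrac f * g + f * dfrac g.
Proof.
rewrite (frac_repr f) (frac_repr g).
have := denom_ratioP (repr f); have := denom_ratioP (repr g).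
move: (repr f).1 (repr f).2 (repr g).1 (repr g).2 => a b c d d0 b0.
rewrite mulf_div -!tofracM !dfrac_div ?mulf_neq0 // !derivM.
rewrite !(tofracB, tofracD, tofracM, tofracXn).
by apply: quotient_ruleM; rewrite tofrac_eq0.
Qed.

Lemma dfracD f g : dfrac (f + g) = dfrac f + dfrac g.
Proof.
rewrite (frac_repr f) (frac_repr g).
have := denom_ratioP (repr f); have := denom_ratioP (repr g).
move: (repr f).1 (repr f).2 (repr g).1 (repr g).2 => a b c d d0 b0.
rewrite addf_div ?tofrac_eq0 // -!tofracM -tofracD !dfrac_div ?mulf_neq0 //.
rewrite derivD !derivM !(tofracB, tofracD, tofracM, tofracXn).
by apply: quotient_ruleD; rewrite tofrac_eq0.
Qed.

End FractionDerivation.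

(** * Differentiating the equation n times *)

(** The recurrence uses nothing of [Q(z)] and of the matrix [A] but a
    derivation [D] with [D z = 1] and an operator [T] satisfying Leibniz' rule,
    that is, a connection. *)
Section DifferentialModule.
Variables (F : comNzRingType) (D : F -> F) (V : lmodType F) (T : V -> V).
Hypothesis DD : forall f g, D (f + g) = D f + D g.
Hypothesis DM : forall f g, D (f * g) = D f * g + f * D g.
Hypothesis TD : forall v w, T (v + w) = T v + T w.
Hypothesis TZ : forall f v, T (f *: v) = D f *: v + f *: T v.

Lemma derivation0 : D 0 = 0.
Proof. by apply: (addrI (D 0)); rewrite -DD !addr0. Qed.

Lemma derivationN f : D (- f) = - D f.
Proof. by apply: (addrI (D f)); rewrite -DD !subrr derivation0. Qed.

Lemma derivation1 : D 1 = 0.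
Proof. by apply: (addrI (D 1)); rewrite -{3}[1]mulr1 DM mulr1 mul1r addr0. Qed.

Lemma derivation_nat n : D n%:R = 0.
Proof.
elim: n => [|n IHn]; first exact: derivation0.
by rewrite -addn1 natrD DD IHn derivation1 addr0.
Qed.

Lemma connection0 : T 0 = 0.
Proof. by apply: (addrI (T 0)); rewrite -TD !addr0. Qed.

Lemma regroup_shifted (a b c d e f g h : V) :
  b + (a + d) + (c + f) + (e + h) + g =
  a + b + (c + d) + (e + f) + (g + h).
Proof. by rewrite (AC (1*2*2*2*1) ((2*1)*(4*3)*(6*5)*(8*7))). Qed.

Variable u : nat -> V.
Hypothesis uS : forall m, T (u m) = u m.+1.

(** Leibniz' rule, applied to a relation between four consecutive vectors.
    The new coefficients are variables, so that an instance can be matched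
    with a relation already written in simplified form. *)
Lemma differentiate_relation p3 p2 p1 p0 q3 q2 q1 q0 n :
    D p3 + p2 = q3 -> D p2 + p1 = q2 -> D p1 + p0 = q1 -> D p0 = q0 ->
    p3 *: u n.+3 + p2 *: u n.+2 + p1 *: u n.+1 + p0 *: u n = 0 ->
  p3 *: u n.+4 + q3 *: u n.+3 + q2 *: u n.+2 + q1 *: u n.+1 + q0 *: u n = 0.
Proof.
move=> <- <- <- <- /(congr1 T); rewrite connection0 !TD !TZ !uS => <-.
by rewrite !scalerDl; apply: regroup_shifted.
Qed.

Variable z : F.
Hypothesis Dz : D z = 1.
Hypothesis ode :
  (36 * (4 * z ^+ 3 - 1)) *: u 2 + (216 * z ^+ 2) *: u 1 + (- 7 * z) *: u 0 = 0.

(** By induction on [n], each instance being the derivative of the previous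
    one; the first is the derivative of [ode].  The last coefficient is
    constant, so that differentiation does not lengthen the relation. *)
Lemma differentiated_ode n :
  (36 * (4 * z ^+ 3 - 1)) *: u n.+3
    + (216 * (2 * n%:R + 3) * z ^+ 2) *: u n.+2
    + ((432 * n.+1%:R ^+ 2 - 7) * z) *: u n.+1
    + (n.+1%:R * (12 * n%:R - 1) * (12 * n%:R + 7)) *: u n = 0.
Proof.
have dE := (derivation_nat, DM, DD, derivationN, derivation1, exprS, Dz).
elim: n => [|n IHn].
  (* A zero leading term makes [ode] a four-term relation. *)
  have ode3 : 0 *: u 3 + (36 * (4 * z ^+ 3 - 1)) *: u 2 + (216 * z ^+ 2) *: u 1
      + (- 7 * z) *: u 0 = 0 by rewrite scale0r add0r.
  rewrite -[_ *: u 3]add0r -{1}(scale0r (u 4)).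
  apply: (differentiate_relation _ _ _ _ ode3).
  - by rewrite derivation0 add0r.
  - by rewrite !dE; ring.
  - by rewrite !dE; ring.
  - by rewrite !dE; ring.
(* The fifth term, with coefficient the derivative of a constant. *)
rewrite -[LHS]addr0 -{1}(scale0r (u n)).
apply: (differentiate_relation _ _ _ _ IHn).
- by rewrite !dE; ring.
- by rewrite !dE; ring.
- by rewrite !dE; ring.
- by rewrite !dE; ring.
Qed.

End DifferentialModule.

(** * Consequences of the recurrence modulo z and modulo 5 *)

Section LameRecurrence.
Variables (R : comNzRingType) (z : R) (x : nat -> R).
Let p : R := 36 * (4 * z ^+ 3 - 1).
Hypothesis ode : p * x 2 + 216 * z ^+ 2 * x 1 + - 7 * z * x 0 = 0.
Hypothesis rec : forall n,
  p * x n.+3 + 216 * (2 * n%:R + 3) * z ^+ 2 * x n.+2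
    + (432 * n.+1%:R ^+ 2 - 7) * z * x n.+1
    + n.+1%:R * (12 * n%:R - 1) * (12 * n%:R + 7) * x n = 0.

(** Since [4 z^3 - 1] is -1 modulo [z], the terms that remain are those in
    [x n.+3] and [x n]. *)
Lemma recurrence_mod_z n :
  36 * x n.+3 - n.+1%:R * (12 * n%:R - 1) * (12 * n%:R + 7) * x n =
  z * (144 * z ^+ 2 * x n.+3 + 216 * (2 * n%:R + 3) * z * x n.+2
       + (432 * n.+1%:R ^+ 2 - 7) * x n.+1).
Proof.
by apply/eqP; rewrite -subr_eq0 -oppr_eq0 -(rec n) /p; apply/eqP; ring.
Qed.

(** Multiplying by [p ^+ 2] makes it possible to eliminate [p x_4] and
    [p x_3], then [p x_2], with the instances 2, 1 and 0 of the recurrence and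
    the equation.  The numbers on the right are the resulting coefficients
    divided by 5, left as sums of products to keep the numerals small. *)
Lemma recurrence5_mod5 :
  p ^+ 2 * x 5 = 5 * (1512 * 216 * z ^+ 4 * x 3
    + (302 * 1721 + 776 * 648 + 818) * z ^+ 3 * x 2
    + (302 * 418 + 3881 * 85 + 427 * 216 + 340) * z ^+ 2 * x 1
    - 1204 * 7 * z * x 0).
Proof.
apply/eqP; rewrite -subr_eq0; apply/eqP.
(* Each 0 stands for one of the relations [rec 2], [rec 1], [rec 0] and [ode];
   the multipliers are the coefficients to eliminate, the last one being
   [2139 = 3 * 23 * 31], the constant coefficient of [rec 2]. *)
transitivity (p * 0 - 1512 * z ^+ 2 * 0 - 3881 * z * 0 - 2139 * 0 : R);
  last by ring.
by rewrite -{1}(rec 2) -{1}(rec 1) -{1}(rec 0) -ode; ring.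
Qed.

(** In [rec 3] the coefficient of [x 4] is [432 * 4 ^ 2 - 7 = 5 * 1381] and
    that of [x 3] is [4 * 35 * 43]. *)
Lemma recurrence6_mod5 y : x 5 = 5 * y ->
  p * x 6 = 5 * - (1944 * z ^+ 2 * y + 1381 * z * x 4 + 28 * 43 * x 3).
Proof.
by move=> x5; apply/eqP; rewrite -subr_eq0 -(rec 3) x5; apply/eqP; ring.
Qed.

End LameRecurrence.

(** * The rows of the iterated matrices *)

(** Differentiation carried over to row vectors: if [Y' = A Y] then
    [(v Y)' = along v Y]. *)
Definition along (v : 'rV[ratfun]_2) : 'rV[ratfun]_2 :=
  map_mx (@dfrac _) v + v *m lameA.

(** The coordinates of the [m]-th derivative of [y] with respect to [y] and
    [y']. *)
Definition lame_row (m : nat) : 'rV[ratfun]_2 := iter m along (delta_mx 0 0).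

Lemma alongD v w : along (v + w) = along v + along w.
Proof.
rewrite /along mulmxDl addrACA; congr (_ + _).
by apply/rowP => j; rewrite !mxE dfracD.
Qed.

Lemma alongZ f v : along (f *: v) = dfrac f *: v + f *: along v.
Proof.
rewrite /along -scalemxAl scalerDr addrA; congr (_ + _).
by apply/rowP=> j; rewrite !mxE dfracM.
Qed.

Lemma lame_rowS m : along (lame_row m) = lame_row m.+1.
Proof. by []. Qed.

Lemma along_delta i : along (delta_mx 0 i) = row i lameA.
Proof.
rewrite /along -rowE; apply/rowP => j; rewrite !mxE -[RHS]add0r; congr (_ + _).
case: (_ && _); last by rewrite -tofrac0 dfrac_tofrac derivC.
by rewrite -tofrac1 dfrac_tofrac derivC.
Qed.

Lemma lame_row1 : lame_row 1 = delta_mx 0 1.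
Proof.
rewrite /lame_row /= along_delta; apply/rowP => j; rewrite !mxE /=.
by case: (unliftP 0 j) => [k ->|->] //; rewrite ord1.
Qed.

(** The recursion defining [lameA_] applies [along] to each row, and the
    second row starts one step ahead because the second entry of [Y] is the
    derivative of the first. *)
Lemma row_lameA_ m i : row i (lameA_ m.+1) = lame_row (i + m.+1).
Proof.
elim: m => [|m IHm]; last first.
  rewrite addnS /lame_row iterS -/(lame_row _) -IHm /lameA_ /= /along.
  by rewrite map_row -row_mul; apply/rowP => j; rewrite !mxE.
rewrite /lameA_ /=; case: (unliftP 0 i) => [k ->|->].
  rewrite ord1 (_ : lift 0 0 = 1); last exact: val_inj.
  by rewrite -along_delta -lame_row1.
by rewrite -along_delta.
Qed.

Lemma lameA_E m i j : lameA_ m.+1 i j = lame_row (i + m.+1) 0 j.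
Proof. by rewrite -row_lameA_ mxE. Qed.

Lemma in_S_lame_row m j : in_S (lame_row m 0 j).
Proof.
case: m => [|m].
  rewrite mxE; case: (_ && _); rewrite -?tofrac0 -?tofrac1; exact: in_S_poly.
by rewrite -[m.+1]add0n -(lameA_E m 0); apply: in_S_lameA_.
Qed.

Lemma lameP_zvar : lameP%:F = 4 * zvar ^+ 3 - 1.
Proof.
rewrite /lameP -mul_polyC polyC_natr tofracB tofracM tofracXn tofrac1.
by rewrite rmorph_nat.
Qed.

Lemma deriv_lameP_zvar : (lameP^`())%:F = 12 * zvar ^+ 2.
Proof.
rewrite /lameP derivB derivZ derivXn derivC subr0 -mul_polyC polyC_natr.
by rewrite mulrnAr -mulrnAl -mulrnA tofracM tofracXn rmorph_nat.
Qed.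

Lemma lame_entry0 (F : fieldType) (p z : F) : p != 0 -> 36 != 0 :> F ->
  36 * p * (7 * z / (36 * p)) + - 7 * z = 0.
Proof. by move=> p0 n0; field; rewrite p0 n0. Qed.

Lemma lame_entry1 (F : fieldType) (p z : F) : p != 0 -> 2 != 0 :> F ->
  36 * p * (- (12 * z ^+ 2) / (2 * p)) + 216 * z ^+ 2 = 0.
Proof. by move=> p0 n0; field; rewrite p0 n0. Qed.

(** Rows 0 to 2 satisfy the Lame equation: this is how the second row of
    [lameA] is obtained from it. *)
Lemma lame_row_ode :
  (36 * (4 * zvar ^+ 3 - 1)) *: lame_row 2 + (216 * zvar ^+ 2) *: lame_row 1
    + (- 7 * zvar) *: lame_row 0 = 0.
Proof.
rewrite -lameP_zvar {1}/lame_row iterS -/(lame_row 1) lame_row1 along_delta.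
apply/rowP => j; rewrite !mxE /= deriv_lameP_zvar.
have n36 := @nat_frac_neq0 36 isT; have n2 := @nat_frac_neq0 2 isT.
have P0 := P_frac_neq0.
case: (unliftP 0 j) => [k ->|->] /=.
  rewrite ord1 /= mulr1 mulr0 addr0.
  exact: lame_entry1 P0 n2.
rewrite mulr0 addr0 mulr1.
exact: lame_entry0 P0 n36.
Qed.

Lemma lame_row_recurrence n :
  (36 * (4 * zvar ^+ 3 - 1)) *: lame_row n.+3
    + (216 * (2 * n%:R + 3) * zvar ^+ 2) *: lame_row n.+2
    + ((432 * n.+1%:R ^+ 2 - 7) * zvar) *: lame_row n.+1
    + (n.+1%:R * (12 * n%:R - 1) * (12 * n%:R + 7)) *: lame_row n = 0.
Proof.
have dz : dfrac zvar = 1 by rewrite dfrac_tofrac derivX tofrac1.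
exact: (differentiated_ode (@dfracD _) (@dfracM _) alongD alongZ lame_rowS dz
  lame_row_ode).
Qed.

Lemma lame_ode_entry j :
  36 * (4 * zvar ^+ 3 - 1) * lame_row 2 0 j + 216 * zvar ^+ 2 * lame_row 1 0 j
    + - 7 * zvar * lame_row 0 0 j = 0.
Proof.
have := lame_row_ode; move: (lame_row 2) (lame_row 1) (lame_row 0) => r2 r1 r0.
by move=> /rowP/(_ j); rewrite !mxE.
Qed.

Lemma lame_recurrence_entry j n :
  36 * (4 * zvar ^+ 3 - 1) * lame_row n.+3 0 j
    + 216 * (2 * n%:R + 3) * zvar ^+ 2 * lame_row n.+2 0 j
    + (432 * n.+1%:R ^+ 2 - 7) * zvar * lame_row n.+1 0 j
    + n.+1%:R * (12 * n%:R - 1) * (12 * n%:R + 7) * lame_row n 0 j = 0.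
Proof.
have := lame_row_recurrence n.
move: (lame_row n.+3) (lame_row n.+2) (lame_row n.+1) (lame_row n).
by move=> r3 r2 r1 r0 /rowP/(_ j); rewrite !mxE.
Qed.

(** * Divisibility in the ring S *)

Lemma in_S_opp f : in_S f -> in_S (- f).
Proof. by case=> p [n ->]; exists (- p), n; rewrite tofracN mulNr. Qed.

Lemma in_S_nat n : in_S n%:R.
Proof. by rewrite -(rmorph_nat (@tofrac _)); apply: in_S_poly. Qed.

Lemma in_S_exp f n : in_S f -> in_S (f ^+ n).
Proof.
move=> Sf; elim: n => [|n IHn]; first by rewrite expr0; apply: (in_S_nat 1).
by rewrite exprS; apply: in_S_mul.
Qed.

Lemma in_S_zvar : in_S zvar.
Proof. exact: in_S_poly. Qed.

(** Membership in the ideal [a S]; it serves both for [a = z] and [a = 5]. *)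
Definition S_dvd (a f : ratfun) : Prop := exists2 g, in_S g & f = a * g.

(** [36 P] is invertible in [S]. *)
Lemma S_dvd_cancel_den a f n :
  S_dvd a ((36 * lameP%:F) ^+ n * f) -> S_dvd a f.
Proof.
case=> _ [p [m ->]] /(canRL (mulKf (expf_neq0 n den_neq0))) ->.
exists (p%:F / (36 * lameP%:F) ^+ (m + n)); first by exists p, (m + n)%N.
by rewrite mulrC -!mulrA -invfM -exprD.
Qed.

(** The quotient of [S] by [z] is [Z[1/36]].  After clearing denominators the
    relation is between polynomials, and its value at 0 gives
    [c (-36)^(n+m) = a p(0) (-36)^m]. *)
Lemma S_dvd_const (a c : nat) f g : coprime a 36 -> in_S f -> in_S g ->
  c%:R = a%:R * f + zvar * g -> (a %| c)%N.
Proof.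
move=> co_a [p [n ->]] [q [m ->]].
set d := 36 * lameP%:F => eq_c.
have d0 k : d ^+ k != 0 by rewrite expf_neq0 ?den_neq0.
have eq_p : c%:R * (36 * lameP) ^+ (n + m) =
    a%:R * p * (36 * lameP) ^+ m + 'X * q * (36 * lameP) ^+ n.
  apply/eqP; rewrite -tofrac_eq; apply/eqP.
  rewrite tofracD !tofracM !tofracXn -den_poly -/d !rmorph_nat eq_c exprD.
  rewrite mulrDl; congr (_ + _).
    by rewrite !mulrA; congr (_ * _); rewrite divfK.
  by rewrite [d ^+ n * _]mulrC !mulrA; congr (_ * _); rewrite divfK.
have P0 : (36 * lameP).[0] = - 36 :> int.
  by rewrite hornerM /lameP -polyC_natr !hornerE.
move: (36 * lameP) P0 eq_p => E P0 /(congr1 (horner^~ 0)) /=.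
rewrite !(hornerD, hornerM, horner_exp) P0 hornerX !mul0r addr0.
rewrite -!polyC_natr !hornerC -mulrA => /(congr1 absz).
rewrite !abszM abszX !natz !absz_nat => eq_abs.
have : (a %| c * 36 ^ (n + m))%N by rewrite eq_abs dvdn_mulr.
by rewrite Gauss_dvdl // coprimeXr.
Qed.

Lemma S_dvdD a f g : S_dvd a f -> S_dvd a g -> S_dvd a (f + g).
Proof.
move=> [s Ss ->] [t St ->]; exists (s + t); first exact: in_S_add.
by rewrite mulrDr.
Qed.

Lemma S_dvdMl a f g : in_S f -> S_dvd a g -> S_dvd a (f * g).
Proof.
move=> Sf [t St ->]; exists (f * t); first exact: in_S_mul.
by rewrite mulrCA.
Qed.

Ltac solve_in_S := cbv beta; repeat match goal with
  | |- in_S (_%:R) => exact: in_S_nat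
  | |- in_S (fun_of_matrix _ _ _) => exact: in_S_lame_row
  | |- in_S zvar => exact: in_S_zvar
  | |- in_S (_ + _) => apply: in_S_add
  | |- in_S (- _) => apply: in_S_opp
  | |- in_S (_ * _) => apply: in_S_mul
  | |- in_S (_ ^+ _) => apply: in_S_exp
  | |- _ => assumption
  end.

Lemma lame_row_step_mod_z n j :
  S_dvd zvar (36 * lame_row n.+3 0 j
    - n.+1%:R * (12 * n%:R - 1) * (12 * n%:R + 7) * lame_row n 0 j).
Proof.
rewrite (recurrence_mod_z (lame_recurrence_entry j) n).
by eexists; last reflexivity; solve_in_S.
Qed.

(** The numerator, over [36 ^ k], of the derivative of order [3 k + 1] at 0 of
    the solution with [y(0) = 0] and [y'(0) = 1]. *)
Definition taylor_num (k : nat) : nat :=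
  \prod_(i < k) ((3 * i + 2) * (36 * i + 11) * (36 * i + 19))%N.

Lemma taylor_numS k : taylor_num k.+1 =
  (taylor_num k * ((3 * k + 2) * (36 * k + 11) * (36 * k + 19)))%N.
Proof. by rewrite /taylor_num big_ord_recr. Qed.

Lemma taylor_num_gt0 k : (0 < taylor_num k)%N.
Proof. by apply: prodn_gt0 => i; rewrite !muln_gt0 !addn_gt0 !orbT. Qed.

(** The factor of [recurrence_mod_z] at [n = 3 k + 1], free of subtractions. *)
Lemma taylor_coefE (R : comNzRingType) k (n := (3 * k).+1) :
  n.+1%:R * (12 * n%:R - 1) * (12 * n%:R + 7) =
  ((3 * k + 2) * (36 * k + 11) * (36 * k + 19))%:R :> R.
Proof. by rewrite /n; ring. Qed.

Lemma telescope_step (R : comNzRingType) (a e x0 x3 c K : R) :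
  a * e * x3 - c * K = e * (a * x3 - K * x0) + K * (e * x0 - c).
Proof. by ring. Qed.

Lemma lame_row_mod_z k :
  S_dvd zvar (36 ^+ k * lame_row (3 * k).+1 0 1 - (taylor_num k)%:R).
Proof.
elim: k => [|k IHk].
  exists 0; first exact: (in_S_nat 0).
  by rewrite lame_row1 mxE /taylor_num big_ord0 mulr0 mul1r subrr.
have := lame_row_step_mod_z (3 * k).+1 1.
rewrite taylor_coefE; set K := (_ * _ * _)%N => step.
have -> : (3 * k.+1).+1 = (3 * k).+1.+3 by rewrite mulnS.
rewrite taylor_numS -/K natrM exprS (telescope_step _ _ (lame_row (3 * k).+1 0 1)).
apply: S_dvdD.
- by apply: S_dvdMl step; solve_in_S.
- by apply: S_dvdMl IHk; solve_in_S.
Qed.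

Lemma logn_taylor_num p k : logn p (taylor_num k) =
  (\sum_(i < k) (logn p (3 * i + 2) + logn p (36 * i + 11)
                 + logn p (36 * i + 19)))%N.
Proof.
elim: k => [|k IHk]; first by rewrite /taylor_num !big_ord0 logn1.
rewrite taylor_numS lognM ?taylor_num_gt0 ?muln_gt0 ?addn_gt0 ?orbT // IHk.
by rewrite big_ord_recr !lognM ?muln_gt0 ?addn_gt0 ?orbT.
Qed.

(** The multiples of 5 among the factors are 5 and 20 for [3 i + 2], 155 for
    [36 i + 11], and 55 and 235 for [36 i + 19]; none is divisible by 25. *)
Lemma logn5_taylor_num : logn 5 (taylor_num 8) = 5.
Proof. by rewrite logn_taylor_num !big_ord_recr big_ord0; vm_compute. Qed.

(** * Divisibility of the fifth matrix by 5 *)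

Lemma lame_row5_mod5 j : S_dvd 5 (lame_row 5 0 j).
Proof.
apply: (@S_dvd_cancel_den _ _ 2).
rewrite lameP_zvar.
rewrite (recurrence5_mod5 (lame_ode_entry j) (lame_recurrence_entry j)).
by eexists; last reflexivity; solve_in_S.
Qed.

Lemma lame_row6_mod5 j : S_dvd 5 (lame_row 6 0 j).
Proof.
apply: (@S_dvd_cancel_den _ _ 1); have [y Sy eq_y] := lame_row5_mod5 j.
rewrite expr1 lameP_zvar.
rewrite (recurrence6_mod5 (lame_recurrence_entry j) eq_y).
by eexists; last reflexivity; solve_in_S.
Qed.

Theorem proposition1p2 : congrS 5 1 (lameA_ 5) 0 /\ ~ congrS 5 6 (lameA_ 25) 0.
Proof.
have n5 : 5 != 0 :> ratfun by apply: nat_frac_neq0.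
split.
  exists (5^-1 *: lameA_ 5); split; last first.
    by rewrite subr0 expr1 scalerA divff // scale1r.
  move=> i j; rewrite mxE lameA_E.
  have [y Sy ->] : S_dvd 5 (lame_row (i + 5) 0 j).
    case: (unliftP 0 i) => [k ->|->]; last exact: lame_row5_mod5.
    by rewrite ord1; apply: lame_row6_mod5.
  by rewrite mulKf.
case=> D [SD /matrixP/(_ 0 1)]; rewrite subr0 lameA_E [RHS]mxE => eq_D.
have [s Ss] := lame_row_mod_z 8.
rewrite [lame_row _ _ _]eq_D => eq_s.
have : (5 ^ 6 %| taylor_num 8)%N.
  apply: (@S_dvd_const _ _ (36 ^+ 8 * D 0 1) (- s)) => //.
  - by apply: in_S_mul => //; apply/in_S_exp/in_S_nat.
  - exact: in_S_opp.
  rewrite natrX mulrN -eq_s opprB mulrCA.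
  by rewrite addrC subrK.
by rewrite pfactor_dvdn ?taylor_num_gt0 // logn5_taylor_num.
Qed.
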